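(* Let $N\ge 1$, let $\mathcal{V}_c=\{1,\dots,N\}$, and let $\mathcal{G}_t=\{\mathcal{V}_c,\mathcal{V}_t,\mathcal{E}_t,\mathcal{W}_t;\mathbf{g}\}$ be a network graph at time $t$ as defined in the context. Let $\Phi$ be the Graph Block (I-GBNet) defined in the context, mapping a network graph to a graph on the same vertices, edges, weights and global attributes, with updated node attributes. Then for every permutation $\pi:[N]\to[N]$ of $\mathcal{V}_c$, with corresponding permutation matrix $P_\pi$, $$\Phi(\pi(\mathcal{G}_t))=\pi(\Phi(\mathcal{G}_t)).$$
   Context: **Network graph.** There are $N$ robots, indexed by $\mathcal{V}_c=\{1,\dots,N\}=[N]$. A network graph at time $t$ is a tuple $\mathcal{G}_t=\{\mathcal{V}_c,\mathcal{V}_t,\mathcal{E}_t,\mathcal{W}_t;\mathbf{g}\}$ where: - $\mathcal{E}_t=\mathcal{E}_{c,t}\cup\{(i,i): i\in\mathcal{V}_c\}$, with $\mathcal{E}_{c,t}\subseteq\mathcal{V}_c\times\mathcal{V}_c$ the set of edges of a directed communication graph. The set of neighbors of $i$ including $i$ itself is $\tilde{\mathcal{N}}_{i,t}=\mathcal{N}_{i,t}\cup\{i\}=\{j:(i,j)\in\mathcal{E}_t\}$. - $\mathcal{W}_t\in\mathbb{R}^{N\times N}$ is the weight matrix, $[\mathcal{W}_t]_{ij}=\kappa_{ij}$ if $(i,j)\in\mathcal{E}_t$ and $0$ otherwise, where $\kappa_{ij}>0$ and $\sum_{j\in\tilde{\mathcal{N}}_{i,t}}\kappa_{ij}=1$ for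 each $i$. - $\mathcal{V}_t=\{\mathbf{V}_{i,t}\}_{i=1}^N$ are the node attributes, $\mathbf{V}_{i,t}=\{\mathbf{p}_{i,t},Z_{i,t},\boldsymbol{\mu}_{i,t},\Omega_{i,t}\}$. Here $\mathbf{p}_{i,t}$ is the position of robot $i$ in the obstacle-free part of an environment $T\subset\mathbb{R}^2$; $\boldsymbol{\mu}_{i,t}\in\mathbb{R}^{d_x}$ and $\Omega_{i,t}=\Sigma_{i,t}^{-1}\in\mathbb{R}^{d_x\times d_x}$ are the mean and information matrix (inverse covariance) of robot $i$'s Gaussian estimate $\mathcal{N}(\boldsymbol{\mu}_{i,t},\Sigma_{i,t})$ of a hidden state in $\mathbb{R}^{d_x}$; and $Z_{i,t}=M(\mathbf{p}_{i,t})^T\mathbf{R}_{i,t}^{-1}M(\mathbf{p}_{i,t})\in\mathbb{R}^{d_x\times d_x}$, where $M(\cdot)$ is the observation matrix and $\mathbf{R}_{i,t}$ the measurement noise covariance of robot $i$. - $\mathbf{g}$ denotes global attributes (e.g. the environment), which determine an occupancy grid map $\mathcal{T}$ of size $\mathcal{T}_H\times\mathcal{T}_W$. **Graph Block $\Phi$.** Fix the following functions, the same for all robots: $\mathcal{I}$, mapping a position to a binary $\mathcal{T}_H\times\mathcal{T}_W$ grid map; the heatmap projection $\mathcal{H}$, mapping a pair (a $d_x\times d_x$ matrix, a vector in $\mathbb{R}^{d_x}$) to a grid heatmap; and the node-update function $\phi^v$ (a convolutional neural network composed with a multilayer perceptron, whose output selects an action), mapping a neighbors-grid map, a robot-grid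 map and a heatmap, together with the occupancy grid map $\mathcal{T}$, to a control action in a finite set $\mathcal{U}$. Given $\mathcal{G}_t$, for each $i\in\mathcal{V}_c$ put $$\hat\Omega_{i,t}=\sum_{j\in\tilde{\mathcal{N}}_{i,t}}\kappa_{ij}\Omega_{j,t}+Z_{i,t},\qquad \hat{\mathbf{p}}_{i,t}=\sum_{j\in\tilde{\mathcal{N}}_{i,t}}\mathcal{I}(\mathbf{p}_{j,t})-\mathcal{I}(\mathbf{p}_{i,t}),$$ $$H_{i,t}=\mathcal{H}(\hat\Omega_{i,t},\boldsymbol{\mu}_{i,t}),\qquad \mathbf{u}_{i,t}=\phi^v(\hat{\mathbf{p}}_{i,t},\mathcal{I}(\mathbf{p}_{i,t}),H_{i,t};\mathcal{T}).$$ Then $\Phi(\mathcal{G}_t)$ is the graph with the same $\mathcal{V}_c,\mathcal{E}_t,\mathcal{W}_t,\mathbf{g}$ and with node attributes $\mathbf{V}'_{i,t}=\{\mathbf{u}_{i,t}\}$. **Action of permutations.** For a permutation $\pi$ of $[N]$, let $P_\pi$ be the permutation matrix with $(P_\pi x)_i=x_{\pi(i)}$. For a graph with node attributes $(\mathbf{V}_i)_{i\in[N]}$, edge set $\mathcal{E}$, weight matrix $\mathcal{W}$ and global attributes $\mathbf{g}$ (either a network graph or an output of $\Phi$), $\pi$ of that graph is the graph whose $i$-th node attribute is $\mathbf{V}_{\pi(i)}$, whose edge set is $\{(i,j):(\pi(i),\pi(j))\in\mathcal{E}\}$, whose weight matrix is $P_\pi\mathcal{W}P_\pi^T$, and whose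 global attributes are $\mathbf{g}$. *)

(* Defs.v *)
From mathcomp Require Import classical_sets reals.
From mathcomp Require Import all_boot all_order all_algebra all_fingroup.
Set Implicit Arguments.
Unset Strict Implicit.
Unset Printing Implicit Defensive.
Import Order.TTheory GRing.Theory Num.Theory.
Local Open Scope ring_scope.

Definition posdefmx (R : realType) (n : nat) (A : 'M[R]_n) : Prop :=
  A^T = A /\ forall x : 'cV[R]_n, x != 0 -> 0 < (x^T *m A *m x) 0 0.

(* A graph on the vertex set 'I_N, with node attributes in A and global
   attributes in Gl. *)
Record graph (R : realType) (N : nat) (A Gl : Type) := Graph {
  attr : {ffun 'I_N -> A};
  edges : {set 'I_N * 'I_N};
  weights : 'M[R]_N;
  global : Gl }.

Definition perm_graph (R : realType) (N : nat) (A Gl : Type) (s : 'S_N)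
    (G : graph R N A Gl) : graph R N A Gl :=
  {| attr := [ffun i => attr G (s i)];
     edges := [set e | (s e.1, s e.2) \in edges G];
     (* [perm_mx s] satisfies (perm_mx s *m x) i = x (s i), see [row_permE] *)
     weights := perm_mx s *m weights G *m (perm_mx s)^T;
     global := global G |}.

(* Since the edge set of a network graph contains the loops, this is the set
   of neighbors of i together with i itself. *)
Definition nbhd (R : realType) (N : nat) (A Gl : Type) (G : graph R N A Gl)
  (i : 'I_N) : {set 'I_N} := [set j | (i, j) \in edges G].

Record node (R : realType) (dx : nat) := Node {
  pos : 'cV[R]_2;
  sensing : 'M[R]_dx;
  mean : 'cV[R]_dx;
  info : 'M[R]_dx }.

(* The sensing model, and the data determined by the global attributes: the
   environment, its obstacles and its occupancy grid map. *)
Record setting (R : realType) (dx dy TH TW : nat) (Gl : Type) := Setting {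
  environment : Gl -> set 'cV[R]_2;
  obstacles : Gl -> set 'cV[R]_2;
  occupancy : Gl -> 'M[R]_(TH, TW);
  observation : 'cV[R]_2 -> 'M[R]_(dy, dx) }.

Record is_node (R : realType) (dx dy TH TW : nat) (Gl : Type)
    (S : setting R dx dy TH TW Gl) (g : Gl) (v : node R dx) : Prop := IsNode {
  pos_free : (environment S g `\` obstacles S g)%classic (pos v);
  info_inv_cov : exists2 Sigma : 'M[R]_dx,
    posdefmx Sigma & info v = invmx Sigma;
  sensingE : exists2 noise : 'M[R]_dy, posdefmx noise &
    sensing v =
      (observation S (pos v))^T *m invmx noise *m observation S (pos v) }.

Record is_network_graph (R : realType) (dx dy TH TW : nat) (Gl : Type)
    (S : setting R dx dy TH TW Gl) (N : nat) (G : graph R N (node R dx) Gl) :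
    Prop := IsNetworkGraph {
  nodeP : forall i, is_node S (global G) (attr G i);
  edgesE : exists Ec : {set 'I_N * 'I_N},
    edges G = Ec :|: [set (i, i) | i : 'I_N];
  weights_gt0 : forall i j, (i, j) \in edges G -> 0 < weights G i j;
  weights_eq0 : forall i j, (i, j) \notin edges G -> weights G i j = 0;
  weights_sum : forall i, \sum_(j in nbhd G i) weights G i j = 1 }.

Record network_graph (R : realType) (dx dy TH TW : nat) (Gl : Type)
    (S : setting R dx dy TH TW Gl) (N : nat) := NetworkGraph {
  graph_of :> graph R N (node R dx) Gl;
  network_graphP : is_network_graph S graph_of }.

Lemma perm_graph_weightsE (R : realType) (N : nat) (A Gl : Type) (s : 'S_N)
    (G : graph R N A Gl) (i j : 'I_N) :
  weights (perm_graph s G) i j = weights G (s i) (s j).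
Proof. by rewrite /= tr_perm_mx -row_permE -col_permE !mxE. Qed.

Lemma perm_is_network_graph (R : realType) (dx dy TH TW : nat) (Gl : Type)
    (S : setting R dx dy TH TW Gl) (N : nat) (s : 'S_N)
    (G : graph R N (node R dx) Gl) :
  is_network_graph S G -> is_network_graph S (perm_graph s G).
Proof.
case=> nodeG [Ec EcE] w_gt0 w_eq0 w_sum; split.
- by move=> i; rewrite /= ffunE.
- exists (edges (perm_graph s G)); apply/esym/setUidPl/subsetP => _ /imsetP[i _ ->].
  by rewrite inE EcE inE; apply/orP; right; apply/imsetP; exists (s i).
- by move=> i j; rewrite perm_graph_weightsE inE; apply: w_gt0.
- by move=> i j; rewrite perm_graph_weightsE inE; apply: w_eq0.
- move=> i; rewrite -[RHS](w_sum (s i)) [RHS](reindex_inj (@perm_inj _ s)) /=.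
  by apply: eq_big => [j|j _]; rewrite ?perm_graph_weightsE // !inE.
Qed.

Definition perm_network_graph (R : realType) (dx dy TH TW : nat) (Gl : Type)
    (S : setting R dx dy TH TW Gl) (N : nat) (s : 'S_N)
    (G : network_graph S N) : network_graph S N :=
  NetworkGraph (perm_is_network_graph s (network_graphP G)).

(* The arguments of [node_update] are the neighbors-grid map, the robot-grid
   map, the heatmap and the occupancy grid map; U is the set of actions. *)
Record block (R : realType) (dx TH TW : nat) (U : finType) := Block {
  grid : 'cV[R]_2 -> 'M[bool]_(TH, TW);
  heatmap : 'M[R]_dx -> 'cV[R]_dx -> 'M[R]_(TH, TW);
  node_update : 'M[R]_(TH, TW) -> 'M[bool]_(TH, TW) -> 'M[R]_(TH, TW) ->
                'M[R]_(TH, TW) -> U }.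

Section GraphBlock.

Context (R : realType) (dx dy TH TW : nat) (U : finType) (Gl : Type)
  (S : setting R dx dy TH TW Gl) (B : block R dx TH TW U)
  (N : nat) (G : network_graph S N).

Definition fused_info (i : 'I_N) : 'M[R]_dx :=
  \sum_(j in nbhd G i) weights G i j *: info (attr G j) + sensing (attr G i).

Definition gridR (p : 'cV[R]_2) : 'M[R]_(TH, TW) :=
  map_mx (fun b : bool => b%:R) (grid B p).

(* The own grid map of robot i is subtracted once, from the whole sum. *)
Definition neighbors_grid (i : 'I_N) : 'M[R]_(TH, TW) :=
  (\sum_(j in nbhd G i) gridR (pos (attr G j))) - gridR (pos (attr G i)).

Definition node_heatmap (i : 'I_N) : 'M[R]_(TH, TW) :=
  heatmap B (fused_info i) (mean (attr G i)).

Definition control (i : 'I_N) : U :=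
  node_update B (neighbors_grid i) (grid B (pos (attr G i))) (node_heatmap i)
    (occupancy S (global G)).

Definition graph_block : graph R N U Gl :=
  {| attr := [ffun i => control i];
     edges := edges G;
     weights := weights G;
     global := global G |}.

End GraphBlock.

(* Main.v *)
Require Import Defs.
From mathcomp Require Import classical_sets reals.
From mathcomp Require Import all_boot all_order all_algebra all_fingroup.
Set Implicit Arguments.
Unset Strict Implicit.
Unset Printing Implicit Defensive.
Import Order.TTheory GRing.Theory Num.Theory.
Local Open Scope ring_scope.

(** All robots apply the same functions, and a robot sees the others only through sums over its
    neighborhood, which do not depend on labels. In the relabelled graph, attributes, edges and
    weights at [i], [j] are those of [G] at [s i], [s j], so the substitution [j -> s j]
    ([sum_nbhd_perm]) turns each sum at [i] into the original one at [s i]. Hence the actions agree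
    ([control_perm]). *)

Lemma mem_nbhd_perm (R : realType) (N : nat) (A Gl : Type) (s : 'S_N)
    (G : graph R N A Gl) (i j : 'I_N) :
  (j \in nbhd (perm_graph s G) i) = (s j \in nbhd G (s i)).
Proof. by rewrite !inE. Qed.

(** Change of variables along the bijection [s]; a general [V] serves both the information matrices
    and the grid maps. *)
Lemma sum_nbhd_perm (R : realType) (N : nat) (A Gl : Type) (V : nmodType)
    (s : 'S_N) (G : graph R N A Gl) (i : 'I_N) (F : 'I_N -> V) :
  \sum_(j in nbhd (perm_graph s G) i) F (s j) = \sum_(j in nbhd G (s i)) F j.
Proof.
rewrite [RHS](reindex_inj (@perm_inj _ s)) /=.
by apply: eq_bigl => j; rewrite mem_nbhd_perm.
Qed.

Section GraphBlockPerm.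

Context (R : realType) (dx dy TH TW : nat) (U : finType) (Gl : Type)
  (S : setting R dx dy TH TW Gl) (B : block R dx TH TW U)
  (N : nat) (G : network_graph S N) (s : 'S_N).

Lemma fused_info_perm (i : 'I_N) :
  fused_info (perm_network_graph s G) i = fused_info G (s i).
Proof.
(* Pulling the sum at [s i] back to the relabelled graph gives both sides one index set, so terms
   can be compared. *)
rewrite /fused_info -(sum_nbhd_perm s G) ffunE; congr (_ + _).
by apply: eq_bigr => j _; rewrite perm_graph_weightsE ffunE.
Qed.

Lemma neighbors_grid_perm (i : 'I_N) :
  neighbors_grid B (perm_network_graph s G) i = neighbors_grid B G (s i).
Proof.
rewrite /neighbors_grid -(sum_nbhd_perm s G) ffunE; congr (_ - _).
by apply: eq_bigr => j _; rewrite ffunE.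
Qed.

Lemma control_perm (i : 'I_N) :
  control B (perm_network_graph s G) i = control B G (s i).
Proof.
by rewrite /control /node_heatmap neighbors_grid_perm fused_info_perm ffunE.
Qed.

End GraphBlockPerm.

Theorem proposition1 (R : realType) (N dx dy TH TW : nat) (hN : (1 <= N)%N)
    (U : finType) (Gl : Type) (S : setting R dx dy TH TW Gl)
    (B : block R dx TH TW U) (G : network_graph S N) (pi : 'S_N) :
  graph_block B (perm_network_graph pi G) = perm_graph pi (graph_block B G).
Proof.
(* The block copies edges, weights and global attributes, so only node attributes remain to
   compare. *)
rewrite /graph_block /perm_graph /=; congr Graph.
by apply/ffunP => i; rewrite !ffunE control_perm.
Qed.
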